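(* Let $F$ be a field of characteristic not $2$ or $3$. Every multilinear polynomial identity of degree $4$ (for one bilinear operation, over $F$) which is satisfied by the dicommutator in every alternative dialgebra over $F$ is a consequence of right anticommutativity $a(bc)+a(cb)\equiv 0$ and the di-Malcev identity $$((ab)c)d - ((ad)b)c - (a(cd))b - (ac)(bd) - a((bc)d) \equiv 0 .$$
   Context: A dialgebra is a vector space $D$ with two bilinear operations $\dashv,\vdash\colon D\times D\to D$. A 0-dialgebra is a dialgebra satisfying the left and right bar identities $(a\dashv b)\vdash c \equiv (a\vdash b)\vdash c$ and $a\dashv(b\dashv c)\equiv a\dashv(b\vdash c)$. In a dialgebra define $(a,b,c)_\dashv = (a\dashv b)\dashv c - a\dashv(b\dashv c)$, $(a,b,c)_\vdash = (a\vdash b)\vdash c - a\vdash(b\vdash c)$, $(a,b,c)_\times = (a\vdash b)\dashv c - a\vdash(b\dashv c)$. An alternative dialgebra is a 0-dialgebra satisfying $(a,b,c)_\dashv+(c,b,a)_\vdash\equiv 0$, $(a,b,c)_\dashv-(b,c,a)_\vdash\equiv 0$, $(a,b,c)_\times+(a,c,b)_\vdash\equiv 0$. The dicommutator in a dialgebra is the bilinear operation $\langle a,b\rangle = a\dashv b - b\vdash a$. A multilinear polynomial identity of degree $n$ for one bilinear operation is an element $I$ of the multilinear subspace of degree $n$ of the free nonassociative algebra over $F$ on $n$ generators; it is satisfied by the dicommutator in $D$ if $I$ vanishes for all values of the variables in $D$ when every product $xy$ is interpreted as $\langle x,y\rangle$. An identity is a consequence of a set of multilinear identities if it lies in the T-ideal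 (ideal closed under all endomorphisms) of the free nonassociative algebra that they generate, equivalently if it holds in every algebra over $F$ satisfying them. *)

(* Defs.v *)
From HB Require Import structures.
From mathcomp Require Import all_boot all_order all_algebra.
From mathcomp Require Import finmap.
From mathcomp.multinomials Require Import monalg.

Set Implicit Arguments.
Unset Strict Implicit.
Unset Printing Implicit Defensive.

Import GRing.Theory.
Local Open Scope ring_scope.

(* Nonassociative monomials: the free magma on X. *)
Inductive magma (X : Type) : Type :=
  | MVar of X
  | MMul of magma X & magma X.

Section MagmaChoice.
Variable X : choiceType.

Fixpoint magma_encode (t : magma X) : GenTree.tree X :=
  match t with
  | MVar x => GenTree.Leaf x
  | MMul t1 t2 => GenTree.Node 0 [:: magma_encode t1; magma_encode t2]
  end.

Fixpoint magma_decode (g : GenTree.tree X) : option (magma X) :=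
  match g with
  | GenTree.Leaf x => Some (MVar x)
  | GenTree.Node _ [:: g1; g2] =>
      if (magma_decode g1, magma_decode g2) is (Some t1, Some t2)
      then Some (MMul t1 t2) else None
  | _ => None
  end.

Lemma magma_encodeK : pcancel magma_encode magma_decode.
Proof. by elim=> //= t1 -> t2 ->. Qed.

HB.instance Definition _ := Choice.copy (magma X) (pcan_type magma_encodeK).
End MagmaChoice.

Fixpoint magma_leaves (X : Type) (t : magma X) : seq X :=
  match t with
  | MVar x => [:: x]
  | MMul t1 t2 => magma_leaves t1 ++ magma_leaves t2
  end.

Fixpoint magma_eval (X A : Type) (op : A -> A -> A) (v : X -> A)
    (t : magma X) : A :=
  match t with
  | MVar x => v x
  | MMul t1 t2 => op (magma_eval op v t1) (magma_eval op v t2)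
  end.

(* The free nonassociative algebra has the free magma as a linear basis. *)
Definition free_na (F : fieldType) (X : choiceType) : lmodType F :=
  {malg F[magma X]}.

Definition na_var (F : fieldType) (X : choiceType) (x : X) : free_na F X :=
  << MVar x >>.

Definition na_mul (F : fieldType) (X : choiceType) (f g : free_na F X) :
    free_na F X :=
  \sum_(s <- msupp f) \sum_(t <- msupp g) << f@_s * g@_t *g MMul s t >>.

Definition na_eval (F : fieldType) (X : choiceType) (A : lmodType F)
    (op : A -> A -> A) (v : X -> A) (f : free_na F X) : A :=
  \sum_(t <- msupp f) f@_t *: magma_eval op v t.

(* Elements of the multilinear subspace of degree n in the n generators:
   every generator occurs exactly once in every monomial. *)
Definition multilinear (F : fieldType) (n : nat) (f : free_na F 'I_n) : Prop :=
  forall t : magma 'I_n, t \in msupp f -> perm_eq (magma_leaves t) (enum 'I_n).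

Definition satisfies (F : fieldType) (X : choiceType) (A : lmodType F)
    (op : A -> A -> A) (f : free_na F X) : Prop :=
  forall v : X -> A, na_eval op v f = 0.

Record T_ideal (F : fieldType) (X : choiceType) (J : free_na F X -> Prop) :
    Prop := {
  T_ideal0 : J 0;
  T_idealD : forall f g, J f -> J g -> J (f + g);
  T_idealZ : forall (c : F) f, J f -> J (c *: f);
  T_idealMl : forall f g, J g -> J (na_mul f g);
  T_idealMr : forall f g, J f -> J (na_mul f g);
  T_ideal_endo : forall phi : {linear free_na F X -> free_na F X},
    (forall f g, phi (na_mul f g) = na_mul (phi f) (phi g)) ->
    forall f, J f -> J (phi f)
}.

(* Membership in the T-ideal generated by S. *)
Definition consequence (F : fieldType) (X : choiceType)
    (S : free_na F X -> Prop) (f : free_na F X) : Prop :=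
  forall J : free_na F X -> Prop,
    T_ideal J -> (forall g, S g -> J g) -> J f.

(* dl is the left product -| and dr is the right product |- . *)
Section Dialgebra.
Variables (F : fieldType) (D : lmodType F).
Variables dl dr : D -> D -> D.
Local Notation "a -| b" := (dl a b) (at level 40, left associativity).
Local Notation "a |- b" := (dr a b) (at level 40, left associativity).

Definition left_assoc (a b c : D) : D := (a -| b) -| c - a -| (b -| c).
Definition right_assoc (a b c : D) : D := (a |- b) |- c - a |- (b |- c).
Definition inner_assoc (a b c : D) : D := (a |- b) -| c - a |- (b -| c).

Record zero_dialgebra : Prop := {
  left_bar : forall a b c : D, (a -| b) |- c = (a |- b) |- c;
  right_bar : forall a b c : D, a -| (b -| c) = a -| (b |- c)
}.

Record alternative_dialgebra : Prop := {
  alt_zero : zero_dialgebra;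
  alt_left_right : forall a b c : D, left_assoc a b c + right_assoc c b a = 0;
  alt_cyclic : forall a b c : D, left_assoc a b c - right_assoc b c a = 0;
  alt_inner_right : forall a b c : D, inner_assoc a b c + right_assoc a c b = 0
}.

Definition dicommutator (a b : D) : D := a -| b - b |- a.

End Dialgebra.

Section Identities.
Variables (F : fieldType) (X : choiceType).
Local Notation "x ** y" := (@na_mul F X x y) (at level 40, left associativity).

Definition right_anticommutativity (a b c : free_na F X) : free_na F X :=
  a ** (b ** c) + a ** (c ** b).

Definition di_Malcev (a b c d : free_na F X) : free_na F X :=
  ((a ** b) ** c) ** d - ((a ** d) ** b) ** c - (a ** (c ** d)) ** b
  - (a ** c) ** (b ** d) - a ** ((b ** c) ** d).

End Identities.

Definition Malcev_dialgebra_identities (F : fieldType) (f : free_na F 'I_4) :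
    Prop :=
  let x (i : nat) : free_na F 'I_4 := na_var F (inord i) in
  f = right_anticommutativity (x 0%N) (x 1%N) (x 2%N) \/
  f = di_Malcev (x 0%N) (x 1%N) (x 2%N) (x 3%N).

(* Main.v *)
(* Only the leftmost letter of a monomial can be the central one: in the
   dialgebra A x A with (a, m) -| (b, n) = (ab, mb) and
   (a, m) |- (b, n) = (ab, an), for A an alternative algebra, the dicommutator
   is ([a, b], [m, b]), so the second component of a monomial is the commutator
   monomial in A with m substituted for the leftmost letter.  Hence for each a
   the monomials of f with leftmost letter a form by themselves an identity of
   the commutator of A.

   Modulo the two identities the monomials with leftmost letter a and remaining
   letters b, c, d are spanned by the six ((ab)c)d, the three (ab)(cd) and the
   single (a(bc))d.  Taking A to be the split octonions, evaluations on basis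
   elements show that these ten are linearly independent as commutator functions
   as soon as 2 and 3 are invertible, so the normal form of f is 0. *)
Require Import Defs.
From HB Require Import structures.
From mathcomp Require Import all_boot all_order all_algebra sesquilinear.
From mathcomp Require Import ring zify finmap.
From mathcomp.multinomials Require Import monalg.

Set Implicit Arguments.
Unset Strict Implicit.
Unset Printing Implicit Defensive.

Import GRing.Theory.
Local Open Scope ring_scope.

(** * The free nonassociative algebra *)

Section FreeAlgebra.
Variables (F : fieldType) (X : choiceType).
Implicit Types (f g : free_na F X) (s t : magma X).

(** The universal property of the free module on the magma. [na_eval] is an instance and [na_mul] a
    nested instance, so their linearity is proved once. *)
Definition linear_extension (V : lmodType F) (h : magma X -> V) f : V :=
  \sum_(t <- msupp f) f@_t *: h t.

(** Allows elements with different supports to be summed over one common index set. *)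
Lemma linear_extensionEw (V : lmodType F) (h : magma X -> V) f
    (d : {fset magma X}) :
  (msupp f `<=` d)%fset -> linear_extension h f = \sum_(t <- d) f@_t *: h t.
Proof.
move=> le_fd; apply: big_fset_incl => // t _ /mcoeff_outdom ->.
by rewrite scale0r.
Qed.

Lemma linear_extension_is_linear (V : lmodType F) (h : magma X -> V) :
  linear (linear_extension h).
Proof.
move=> k f g; set d := (msupp f `|` msupp g)%fset.
rewrite (@linear_extensionEw _ _ f d) ?fsubsetUl //.
rewrite (@linear_extensionEw _ _ g d) ?fsubsetUr //.
rewrite (@linear_extensionEw _ _ _ d); last first.
  apply: (fsubset_trans (msuppD_le _ _)); apply: fsetSU; exact: msuppZ_le.
rewrite scaler_sumr -big_split /=; apply: eq_bigr => t _.
by rewrite mcoeffD mcoeffZ scalerDl scalerA.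
Qed.

HB.instance Definition _ (V : lmodType F) (h : magma X -> V) :=
  GRing.isLinear.Build F (free_na F X) V *:%R (linear_extension h)
    (linear_extension_is_linear h).

Lemma linear_extensionU (V : lmodType F) (h : magma X -> V) t :
  linear_extension h << t >> = h t.
Proof.
by rewrite /linear_extension msuppU oner_eq0 big_seq_fset1 mcoeffUU scale1r.
Qed.

Lemma monomialZ (k : F) t : << k *g t >> = k *: (<< t >> : free_na F X).
Proof.
by apply/malgP => s; rewrite mcoeffU mcoeffZ mcoeffU mulrnAr mulr1.
Qed.

Lemma free_naE f : f = \sum_(t <- msupp f) f@_t *: (<< t >> : free_na F X).
Proof. by rewrite {1}(monalgE f); apply: eq_bigr => t _; rewrite monomialZ. Qed.

Lemma free_na_ind (P : free_na F X -> Prop) :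
  P 0 -> (forall k f g, P f -> P g -> P (k *: f + g)) ->
  (forall t, P << t >>) -> forall f, P f.
Proof.
move=> P0 PP PU f; rewrite (free_naE f).
by elim/big_rec: _ => // t g _ Pg; exact: PP.
Qed.

Lemma na_mulE f g : na_mul f g =
  linear_extension (fun s => linear_extension (fun t => << MMul s t >>) g) f.
Proof.
apply: eq_bigr => s _; rewrite /linear_extension scaler_sumr.
by apply: eq_bigr => t _; rewrite monomialZ scalerA.
Qed.

Lemma na_mulPl k f g h :
  na_mul (k *: f + g) h = k *: na_mul f h + na_mul g h.
Proof. by rewrite !na_mulE linearP. Qed.

Lemma na_mulPr k f g h :
  na_mul f (k *: g + h) = k *: na_mul f g + na_mul f h.
Proof.
rewrite !na_mulE /linear_extension scaler_sumr -big_split /=.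
apply: eq_bigr => s _; rewrite -!/(linear_extension _ _) linearP.
by rewrite scalerDr !scalerA mulrC.
Qed.

Lemma na_mul_bilinear : bilinear_for *:%R *:%R (@na_mul F X).
Proof. by split=> h k f g; [exact: na_mulPl | exact: na_mulPr]. Qed.

HB.instance Definition _ :=
  bilinear_isBilinear.Build F (free_na F X) (free_na F X) (free_na F X)
    *:%R *:%R (@na_mul F X) na_mul_bilinear.

Lemma na_mulU s t : na_mul << s >> << t >> = << MMul s t >> :> free_na F X.
Proof. by rewrite na_mulE !linear_extensionU. Qed.

HB.instance Definition _ (A : lmodType F) (op : A -> A -> A) (v : X -> A) :=
  GRing.Linear.copy (na_eval op v : free_na F X -> A)
    (linear_extension (magma_eval op v)).

Lemma na_evalU (A : lmodType F) (op : A -> A -> A) (v : X -> A) t :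
  na_eval op v << t >> = magma_eval op v t.
Proof. exact: linear_extensionU. Qed.

Lemma na_eval0 (A : lmodType F) (op : A -> A -> A) (v : X -> A) :
  na_eval op v (0 : free_na F X) = 0.
Proof. exact: linear0. Qed.

Lemma na_evalP (A : lmodType F) (op : A -> A -> A) (v : X -> A) k f g :
  na_eval op v (k *: f + g) = k *: na_eval op v f + na_eval op v g.
Proof. exact: linearP. Qed.

Lemma na_evalD (A : lmodType F) (op : A -> A -> A) (v : X -> A) f g :
  na_eval op v (f + g) = na_eval op v f + na_eval op v g.
Proof. exact: linearD. Qed.

Lemma na_evalB (A : lmodType F) (op : A -> A -> A) (v : X -> A) f g :
  na_eval op v (f - g) = na_eval op v f - na_eval op v g.
Proof. exact: linearB. Qed.

Lemma na_eval_sum (A : lmodType F) (op : A -> A -> A) (v : X -> A) (I : Type)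
    (r : seq I) (c : I -> F) (g : I -> free_na F X) :
  na_eval op v (\sum_(i <- r) c i *: g i) =
  \sum_(i <- r) c i *: na_eval op v (g i).
Proof.
elim: r => [|i r IH]; first by rewrite !big_nil na_eval0.
by rewrite !big_cons na_evalP IH.
Qed.

Lemma na_eval_mul (A : lmodType F) (op : {bilinear A -> A -> A}) (v : X -> A)
    f g :
  na_eval op v (na_mul f g) = op (na_eval op v f) (na_eval op v g).
Proof.
elim/free_na_ind: f => [|k f1 f2 IH1 IH2|s].
- by rewrite na_eval0 !linear0l na_eval0.
- rewrite na_mulPl (na_evalP op v k (na_mul f1 g)) (na_evalP op v k f1).
  rewrite linearPl.
  by congr (_ *: _ + _).
elim/free_na_ind: g => [|k g1 g2 IH1 IH2|t].
- by rewrite na_eval0 !linear0r na_eval0.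
- rewrite na_mulPr (na_evalP op v k (na_mul _ g1)) (na_evalP op v k g1).
  rewrite linearPr.
  by congr (_ *: _ + _).
by rewrite na_mulU (na_evalU op v (MMul s t)) !na_evalU.
Qed.

(** An endomorphism is determined by the images of the generators, so composing it with an
    evaluation only changes the point of evaluation. Hence the identities of an algebra are closed
    under endomorphisms. *)
Lemma na_eval_endo (A : lmodType F) (op : {bilinear A -> A -> A}) (v : X -> A)
    (phi : {linear free_na F X -> free_na F X}) f :
  (forall f g, phi (na_mul f g) = na_mul (phi f) (phi g)) ->
  na_eval op v (phi f) =
  na_eval op (fun x => na_eval op v (phi (na_var F x))) f.
Proof.
move=> phiM; elim/free_na_ind: f => [|k f g IHf IHg|t].
- by rewrite linear0 !na_eval0.
- by rewrite (linearP phi) !na_evalP IHf IHg.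
rewrite na_evalU; elim: t => [x //|s IHs t IHt] /=.
rewrite -na_mulU phiM na_eval_mul; exact: (congr2 op).
Qed.

Lemma satisfies_T_ideal (A : lmodType F) (op : {bilinear A -> A -> A}) :
  T_ideal (@satisfies F X A op).
Proof.
split=> [v|f g Jf Jg v|c f Jf v|f g Jg v|f g Jf v|phi phiM f Jf v].
- exact: na_eval0.
- by rewrite -[f]scale1r na_evalP Jf Jg scaler0 addr0.
- by rewrite -[c *: f]addr0 na_evalP na_eval0 Jf scaler0 addr0.
- by rewrite na_eval_mul Jg linear0r.
- by rewrite na_eval_mul Jf linear0l.
- by rewrite na_eval_endo.
Qed.

Lemma consequence_T_ideal (S : free_na F X -> Prop) : T_ideal (consequence S).
Proof.
split=> [|f g Jf Jg|c f Jf|f g Jg|f g Jf|phi phiM f Jf] J TJ SJ.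
- exact: T_ideal0.
- by apply: T_idealD => //; [exact: Jf | exact: Jg].
- by apply: T_idealZ => //; exact: Jf.
- by apply: T_idealMl => //; exact: Jg.
- by apply: T_idealMr => //; exact: Jf.
- by apply: (T_ideal_endo TJ phiM); exact: Jf.
Qed.

(** Substituting [u] for the generators is evaluation in the free algebra itself, which is an
    endomorphism. *)
Lemma consequence_subst (S : free_na F X -> Prop) (u : X -> free_na F X) f :
  S f -> consequence S (na_eval (@na_mul F X) u f).
Proof.
move=> Sf J TJ SJ; apply: (T_ideal_endo TJ (phi := na_eval (@na_mul F X) u)).
  exact: na_eval_mul.
exact: SJ.
Qed.

Lemma na_eval_right_anticommutativity (A : lmodType F)
    (op : {bilinear A -> A -> A}) (v : X -> A) f g h :
  let ev := na_eval op v in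
  ev (right_anticommutativity f g h) =
  op (ev f) (op (ev g) (ev h)) + op (ev f) (op (ev h) (ev g)).
Proof.
move=> ev; rewrite /right_anticommutativity.
have evM p q : ev (na_mul p q) = op (ev p) (ev q) by exact: na_eval_mul.
have evD p q : ev (p + q) = ev p + ev q by exact: na_evalD.
(* Generalized so that unification does not compare products by unfolding. *)
move: ev evM evD => ev; move: (@na_mul F X) => m evM evD.
by rewrite evD !evM.
Qed.

Lemma na_eval_di_Malcev (A : lmodType F) (op : {bilinear A -> A -> A})
    (v : X -> A) f g h k :
  let ev := na_eval op v in
  ev (di_Malcev f g h k) =
  op (op (op (ev f) (ev g)) (ev h)) (ev k)
  - op (op (op (ev f) (ev k)) (ev g)) (ev h)
  - op (op (ev f) (op (ev h) (ev k))) (ev g)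
  - op (op (ev f) (ev h)) (op (ev g) (ev k))
  - op (ev f) (op (op (ev g) (ev h)) (ev k)).
Proof.
move=> ev; rewrite /di_Malcev.
have evM p q : ev (na_mul p q) = op (ev p) (ev q) by exact: na_eval_mul.
have evB p q : ev (p - q) = ev p - ev q by exact: na_evalB.
move: ev evM evB => ev; move: (@na_mul F X) => m evM evB.
by rewrite !evB !evM.
Qed.

Lemma magma_eval_na_var t :
  magma_eval (@na_mul F X) (@na_var F X) t = << t >>.
Proof. by elim: t => //= s -> t ->; exact: na_mulU. Qed.

End FreeAlgebra.

(** * Reduction modulo the two identities *)

Local Notation S3 i j k := (perm_eq [:: i; j; k] (iota 0 3)).

Lemma S3_ind (P : nat -> nat -> nat -> Prop) :
  P 0 1 2 -> P 0 2 1 -> P 1 0 2 -> P 1 2 0 -> P 2 0 1 -> P 2 1 0 ->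
  forall i j k, S3 i j k -> P i j k.
Proof.
move=> P012 P021 P102 P120 P201 P210 i j k; rewrite -mem_permutations.
(* The order of the list is the one that [permutations] computes. *)
have -> : permutations (iota 0 3) = [:: [:: 1; 0; 2]; [:: 0; 1; 2];
   [:: 2; 0; 1]; [:: 0; 2; 1]; [:: 1; 2; 0]; [:: 2; 1; 0]] by [].
by rewrite !inE => /or4P[||| /or3P[]] /eqP[-> -> ->].
Qed.

Lemma S3_swap i j k : S3 i j k -> S3 j i k.
Proof. by rewrite -(perm_catCA [:: i] [:: j] [:: k]). Qed.

Lemma S3_rot i j k : S3 i j k -> S3 j k i.
Proof. by rewrite -[[:: i; j; k]]cat1s perm_catC. Qed.

Section Reduction.
Variables (V : zmodType) (mul : V -> V -> V) (W : V -> Prop).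
Local Notation "x ** y" := (mul x y) (at level 40, left associativity).
Hypotheses (WD : forall f g, W f -> W g -> W (f + g))
  (WN : forall f, W f -> W (- f)).
Hypotheses (W_anticomm : forall a b c, W (a ** (b ** c) + a ** (c ** b)))
  (W_anticomml : forall a b c d, W (a ** (b ** c) ** d + a ** (c ** b) ** d))
  (W_anticommr : forall a b c d,
     W (a ** (b ** c ** d) + a ** (c ** b ** d)))
  (W_di_Malcev : forall a b c d,
     W (a ** b ** c ** d - a ** d ** b ** c - a ** (c ** d) ** b
        - (a ** c) ** (b ** d) - a ** (b ** c ** d))).

Let WB f g : W f -> W g -> W (f - g).
Proof. by move=> Wf Wg; apply: WD (WN _). Qed.

Let WDr f g : W f -> W (f + g) -> W g.
Proof. by move=> Wf Wfg; rewrite -[g](addKr f); apply/WD/Wfg/WN. Qed.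

Let WBr f g : W f -> W (f - g) -> W g.
Proof. by move=> Wf /(WDr Wf)/WN; rewrite opprK. Qed.

Let WBl f g : W g -> W (f - g) -> W f.
Proof. by move=> Wg Wfg; rewrite -[f](subrK g); apply: WD. Qed.

Let W_swap a b c : W (a ** (b ** c)) -> W (a ** (c ** b)).
Proof. by move=> Wabc; apply: (WDr Wabc). Qed.

Let W_swapl a b c d : W (a ** (b ** c) ** d) -> W (a ** (c ** b) ** d).
Proof. by move=> Wabc; apply: (WDr Wabc). Qed.

Variables (a : V) (x : nat -> V).
Hypothesis W_left : forall i j k, S3 i j k -> W (a ** x i ** x j ** x k).
Hypothesis W_split0 : W ((a ** x 0) ** (x 1 ** x 2)).
Hypothesis W_split1 : W ((a ** x 1) ** (x 0 ** x 2)).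
Hypothesis W_split2 : W ((a ** x 2) ** (x 0 ** x 1)).
Hypothesis W_mid : W ((a ** (x 0 ** x 1)) ** x 2).

Lemma W_split i j k : S3 i j k -> W ((a ** x i) ** (x j ** x k)).
Proof. by move: i j k; apply: S3_ind => //; exact: W_swap. Qed.

(** The di-Malcev identity is solved for its nested term: two of the other four terms are
    left-normed, one is split and one is the assumed product. *)
Let W_nested i j k : S3 i j k ->
  W (a ** (x j ** x k) ** x i) -> W (a ** (x i ** x j ** x k)).
Proof.
move=> Sijk Wjk.
have := W_di_Malcev a (x i) (x j) (x k); apply: WBr.
apply: WB (W_split (S3_swap Sijk)); apply: WB Wjk.
apply: WB (W_left Sijk) (W_left _).
by apply/S3_rot/S3_rot.
Qed.

(* Exchanging b and c in di_Malcev a b c d changes the sign of its nested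
   product a((bc)d), which is thereby eliminated. *)
Let W_mid_exchange i j k : S3 i j k ->
  W (a ** (x j ** x k) ** x i) -> W (a ** (x i ** x k) ** x j).
Proof.
move=> Sijk Wjk.
have Wjik : W (a ** (x j ** x i ** x k)).
  exact: WDr (W_nested Sijk Wjk) (W_anticommr _ _ _ _).
have := W_di_Malcev a (x j) (x i) (x k).
move=> /(WBl Wjik) /(WBl (W_split Sijk)); apply: WBr.
apply: WB (W_left (S3_swap Sijk)) (W_left _).
exact/S3_swap/S3_rot.
Qed.

(** Up to anticommutativity there are three such products, told apart by their last letter. One
    exchange from [W_mid] reaches each of the other two. *)
Let W_mids i j k : S3 i j k -> W (a ** (x i ** x j) ** x k).
Proof.
have W210 : W (a ** (x 2 ** x 1) ** x 0) by exact: W_mid_exchange W_mid.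
have W201 : W (a ** (x 2 ** x 0) ** x 1).
  by apply: W_mid_exchange => //; exact: W_swapl.
by move: i j k; apply: S3_ind => //; exact: W_swapl.
Qed.

(** The conjuncts are the five bracketings of four letters beginning with [a]. The hypotheses on [W]
    ask only for the ten normal products; later [W] is the set of elements congruent to combinations
    of normal monomials. *)
Lemma di_Malcev_span i j k : S3 i j k ->
  [/\ W (a ** x i ** x j ** x k), W (a ** (x i ** x j) ** x k),
      W (a ** x i ** (x j ** x k)), W (a ** (x i ** x j ** x k)) &
      W (a ** (x i ** (x j ** x k)))].
Proof.
move=> Sijk; split; [exact: W_left | exact: W_mids | exact: W_split | | ].
  exact: W_nested (W_mids (S3_rot Sijk)).
have Sjki := S3_rot Sijk.
exact: W_swap (W_nested Sjki (W_mids (S3_rot Sjki))).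
Qed.
End Reduction.

(** * Instances and multiples of the two identities in the free algebra *)

Section Consequences.
Variable F : fieldType.
Local Notation A := (free_na F 'I_4).
Local Notation J := (consequence (@Malcev_dialgebra_identities F)).
Local Notation "x ** y" := (@na_mul F 'I_4 x y)
  (at level 40, left associativity).

Lemma consequence_right_anticommutativity (a b c : A) :
  J (right_anticommutativity a b c).
Proof.
(* The fourth generator, absent from this identity, is sent to the default value 0. *)
pose u (i : 'I_4) := [:: a; b; c]`_i.
have congr_anticomm a' b' c' : a' = a -> b' = b -> c' = c ->
  right_anticommutativity a' b' c' = right_anticommutativity a b c.
  by do 3 move->.
have /(consequence_subst u) : Malcev_dialgebra_identities
    (right_anticommutativity (na_var F (inord 0)) (na_var F (inord 1))
      (na_var F (inord 2))) by left.
congr J; rewrite na_eval_right_anticommutativity.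
by apply: congr_anticomm; rewrite na_evalU /= /u inordK.
Qed.

Lemma consequence_di_Malcev (a b c d : A) : J (di_Malcev a b c d).
Proof.
pose u (i : 'I_4) := [:: a; b; c; d]`_i.
have congr_di_Malcev a' b' c' d' : a' = a -> b' = b -> c' = c -> d' = d ->
  di_Malcev a' b' c' d' = di_Malcev a b c d by do 4 move->.
have /(consequence_subst u) : Malcev_dialgebra_identities
    (di_Malcev (na_var F (inord 0)) (na_var F (inord 1)) (na_var F (inord 2))
      (na_var F (inord 3))) by right.
congr J; rewrite na_eval_di_Malcev.
by apply: congr_di_Malcev; rewrite na_evalU /= /u inordK.
Qed.

Let TJ := consequence_T_ideal (@Malcev_dialgebra_identities F).

Lemma consequence_anticomml a b c d :
  J (a ** (b ** c) ** d + a ** (c ** b) ** d).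
Proof.
rewrite -linearDl; apply: (T_idealMr TJ).
exact: consequence_right_anticommutativity.
Qed.

(** Right anticommutativity exchanges the factors of a right factor only. So [b ** c] is first moved
    to the right of [d], its factors are exchanged there, and the result is moved back. *)
Lemma consequence_nested_anticomm a b c d :
  J (a ** (b ** c ** d) + a ** (c ** b ** d)).
Proof.
have JBr f g : J (f + g) -> J g -> J f.
  move=> Jfg Jg; rewrite -[f](addrK g).
  by apply: (T_idealD TJ Jfg); rewrite -scaleN1r; apply: (T_idealZ TJ).
have Jd : J (a ** (d ** (b ** c)) + a ** (d ** (c ** b))).
  rewrite -linearDr; apply: (T_idealMl TJ).
  exact: consequence_right_anticommutativity.
apply: JBr Jd; rewrite addrACA; apply: (T_idealD TJ);
  exact: consequence_right_anticommutativity.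
Qed.

End Consequences.

(** * Alternative dialgebras from alternative algebras *)

Definition associator (V : zmodType) (mul : V -> V -> V) (a b c : V) : V :=
  mul (mul a b) c - mul a (mul b c).

Definition commutator (V : zmodType) (mul : V -> V -> V) (a b : V) : V :=
  mul a b - mul b a.

Section Dicommutator.
Variables (F : fieldType) (D : lmodType F).

Lemma dicommutator_bilinear (dl dr : {bilinear D -> D -> D}) :
  bilinear_for *:%R *:%R (dicommutator dl dr).
Proof.
by split=> z k x y;
  rewrite /dicommutator linearPl linearPr /= scalerBr opprD addrACA.
Qed.

HB.instance Definition _ (dl dr : {bilinear D -> D -> D}) :=
  bilinear_isBilinear.Build F D D D *:%R *:%R
    (dicommutator dl dr) (dicommutator_bilinear dl dr).

End Dicommutator.

Section SplitNull.
Variables (F : fieldType) (A : lmodType F) (mul : {bilinear A -> A -> A}).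
Implicit Types x y z : A * A.
Local Notation associator := (associator mul).
Local Notation commutator := (commutator mul).

(** Second components are elements of the regular bimodule of [A]; this product takes the module
    element from the left factor, [null_right] from the right one. *)
Definition null_left x y : A * A := (mul x.1 y.1, mul x.2 y.1).
Definition null_right x y : A * A := (mul x.1 y.1, mul x.1 y.2).

Lemma null_left_bilinear : bilinear_for *:%R *:%R null_left.
Proof. by split=> z k x y; congr pair; rewrite /= ?linearPl ?linearPr. Qed.

Lemma null_right_bilinear : bilinear_for *:%R *:%R null_right.
Proof. by split=> z k x y; congr pair; rewrite /= ?linearPl ?linearPr. Qed.

HB.instance Definition _ := bilinear_isBilinear.Build F (A * A)%type
  (A * A)%type (A * A)%type *:%R *:%R null_left null_left_bilinear.
HB.instance Definition _ := bilinear_isBilinear.Build F (A * A)%type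
  (A * A)%type (A * A)%type *:%R *:%R null_right null_right_bilinear.

Hypothesis associatorC12 :
  forall a b c, associator a b c + associator b a c = 0.
Hypothesis associatorC23 :
  forall a b c, associator a b c + associator a c b = 0.

(** The second component of each dialgebra associator is an associator of [A] whose module entry
    stands first, last or in the middle. The axioms thus reduce to the associator of [A] being
    alternating. *)
Lemma null_alternative : alternative_dialgebra null_left null_right.
Proof.
have swap12 a b c : associator a b c = - associator b a c.
  by apply/eqP; rewrite -addr_eq0 associatorC12.
have swap23 a b c : associator a b c = - associator a c b.
  by apply/eqP; rewrite -addr_eq0 associatorC23.
have rot a b c : associator a b c = associator b c a.
  by rewrite swap12 swap23 opprK.
have leftE x y z : left_assoc null_left x y z =
  (associator x.1 y.1 z.1, associator x.2 y.1 z.1) by [].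
have rightE x y z : right_assoc null_right x y z =
  (associator x.1 y.1 z.1, associator x.1 y.1 z.2) by [].
have innerE x y z : inner_assoc null_left null_right x y z =
  (associator x.1 y.1 z.1, associator x.1 y.2 z.1) by [].
split=> // x y z; rewrite ?leftE ?rightE ?innerE; congr pair => /=.
1,2: by rewrite rot swap12 addNr.
1,2: by rewrite rot subrr.
all: by rewrite swap23 addNr.
Qed.

Local Notation D := (A * A)%type.
Local Notation dicomm := (dicommutator null_left null_right).

Section Evaluation.
Variables (X : Type) (v : X -> D).

Lemma null_eval1 t :
  (magma_eval dicomm v t).1 = magma_eval commutator (fst \o v) t.
Proof. by elim: t => //= s <- t <-. Qed.

Fixpoint magma_head (t : magma X) : X :=
  match t with MVar i => i | MMul s _ => magma_head s end.

(** The second component of a dicommutator takes only the second component of its left factor, so by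
    descent along left factors only the leftmost letter contributes one. With [null_eval2_0] this
    lets a valuation select the monomials with a given leftmost letter. *)
Lemma null_eval2 t : (v (magma_head t)).2 = (v (magma_head t)).1 ->
  (magma_eval dicomm v t).2 = magma_eval commutator (fst \o v) t.
Proof.
by rewrite -null_eval1; elim: t => [i //|s IHs t _ /= /IHs /= ->].
Qed.

Lemma null_eval2_0 t : (v (magma_head t)).2 = 0 ->
  (magma_eval dicomm v t).2 = 0.
Proof.
elim: t => [i //|s IHs t _ /= /IHs].
by move=> ->; rewrite /commutator linear0l linear0r subrr.
Qed.
End Evaluation.

Hypothesis commutator_Malcev : forall a b c d,
  commutator (commutator (commutator a b) c) d
  - commutator (commutator (commutator a d) b) c
  - commutator (commutator a (commutator c d)) b
  - commutator (commutator a c) (commutator b d)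
  - commutator a (commutator (commutator b c) d) = 0.

Lemma commutator_anticomm a b c :
  commutator a (commutator b c) + commutator a (commutator c b) = 0.
Proof.
have -> : commutator c b = - commutator b c by rewrite /commutator opprB.
move: (commutator b c) => d.
by rewrite /commutator linearNr linearNl -opprD subrr.
Qed.

(** The identities of an algebra form a T-ideal, so the two generators suffice. In each of them both
    components are the same commutator identity of [A], the second with the module part of the
    leading argument. *)
Lemma null_consequence f : consequence (@Malcev_dialgebra_identities F) f ->
  satisfies dicomm f.
Proof.
apply; first exact: satisfies_T_ideal.
move=> _ [] -> v.
  rewrite na_eval_right_anticommutativity.
  by congr pair; exact: commutator_anticomm.
by rewrite na_eval_di_Malcev; congr pair; exact: commutator_Malcev.
Qed.
End SplitNull.

(** * Split octonions *)

(** Tuples over the regular module inherit their module structure. The base ring is general because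
    both [F] and [int] are used. *)
Definition zorn (R : comNzRingType) : lmodType R :=
  (R^o * R^o * R^o * R^o * R^o * R^o * R^o * R^o)%type.

(* Zorn's vector matrices (a, u; v, b).  Locked so that rewriting with the
   coordinate formulas does not unfold sums of tuples into projections. *)
HB.lock Definition Zorn (R : comNzRingType) (a u1 u2 u3 v1 v2 v3 b : R) :
    zorn R :=
  (a, u1, u2, u3, v1, v2, v3, b).

Section Zorn.
Variable R : comNzRingType.
Local Notation zorn := (zorn R).

Variant zorn_spec : zorn -> Prop :=
  ZornSpec a u1 u2 u3 v1 v2 v3 b : zorn_spec (Zorn a u1 u2 u3 v1 v2 v3 b).

Lemma zornP x : zorn_spec x.
Proof.
case: x => [[[[[[[a u1] u2] u3] v1] v2] v3] b].
by move: (ZornSpec a u1 u2 u3 v1 v2 v3 b); rewrite Zorn.unlock.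
Qed.

(** Zorn's product, with dot and cross products of vectors: the diagonal entries are aa' + u.v' and
    bb' + v.u', the vectors are au' + b'u - v x v' and a'v + bv' + u x u'. *)
Definition zorn_mul (x y : zorn) : zorn :=
  let: (a, u1, u2, u3, v1, v2, v3, b) := x in
  let: (a', u1', u2', u3', v1', v2', v3', b') := y in
  (a * a' + (u1 * v1' + u2 * v2' + u3 * v3') : R,
   a * u1' + b' * u1 - (v2 * v3' - v3 * v2') : R,
   a * u2' + b' * u2 - (v3 * v1' - v1 * v3') : R,
   a * u3' + b' * u3 - (v1 * v2' - v2 * v1') : R,
   a' * v1 + b * v1' + (u2 * u3' - u3 * u2') : R,
   a' * v2 + b * v2' + (u3 * u1' - u1 * u3') : R,
   a' * v3 + b * v3' + (u1 * u2' - u2 * u1') : R,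
   b * b' + (v1 * u1' + v2 * u2' + v3 * u3') : R).

Section Coordinates.
Variables a u1 u2 u3 v1 v2 v3 b a' u1' u2' u3' v1' v2' v3' b' k : R.
Local Notation x := (Zorn a u1 u2 u3 v1 v2 v3 b).
Local Notation y := (Zorn a' u1' u2' u3' v1' v2' v3' b').

Lemma zornD : x + y = Zorn (a + a') (u1 + u1') (u2 + u2') (u3 + u3')
  (v1 + v1') (v2 + v2') (v3 + v3') (b + b').
Proof. by rewrite !Zorn.unlock. Qed.

Lemma zornN : - x = Zorn (- a) (- u1) (- u2) (- u3) (- v1) (- v2) (- v3) (- b).
Proof. by rewrite !Zorn.unlock. Qed.

Lemma zornZ : k *: x = Zorn (k * a) (k * u1) (k * u2) (k * u3)
  (k * v1) (k * v2) (k * v3) (k * b).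
Proof. by rewrite !Zorn.unlock. Qed.

Lemma zorn_mulE : zorn_mul x y =
  Zorn (a * a' + (u1 * v1' + u2 * v2' + u3 * v3'))
    (a * u1' + b' * u1 - (v2 * v3' - v3 * v2'))
    (a * u2' + b' * u2 - (v3 * v1' - v1 * v3'))
    (a * u3' + b' * u3 - (v1 * v2' - v2 * v1'))
    (a' * v1 + b * v1' + (u2 * u3' - u3 * u2'))
    (a' * v2 + b * v2' + (u3 * u1' - u1 * u3'))
    (a' * v3 + b * v3' + (u1 * u2' - u2 * u1'))
    (b * b' + (v1 * u1' + v2 * u2' + v3 * u3')).
Proof. by rewrite /zorn_mul !Zorn.unlock. Qed.

End Coordinates.

Lemma zorn0 : (0 : zorn) = Zorn 0 0 0 0 0 0 0 0.
Proof. by rewrite Zorn.unlock. Qed.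

Definition zornE := (zorn_mulE, zornD, zornN, zornZ, zorn0).

Implicit Types x y z : zorn.

Lemma zorn_mulPl k x y z :
  zorn_mul (k *: x + y) z = k *: zorn_mul x z + zorn_mul y z.
Proof.
case: (zornP x) => *; case: (zornP y) => *; case: (zornP z) => *.
by rewrite !zornE; congr Zorn; ring.
Qed.

Lemma zorn_mulPr k x y z :
  zorn_mul x (k *: y + z) = k *: zorn_mul x y + zorn_mul x z.
Proof.
case: (zornP x) => *; case: (zornP y) => *; case: (zornP z) => *.
by rewrite !zornE; congr Zorn; ring.
Qed.

Lemma zorn_mul_bilinear : bilinear_for *:%R *:%R zorn_mul.
Proof. by split=> z k x y; [exact: zorn_mulPl | exact: zorn_mulPr]. Qed.

HB.instance Definition _ :=
  bilinear_isBilinear.Build R zorn zorn zorn *:%R *:%R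
    zorn_mul zorn_mul_bilinear.

Lemma zorn_associatorC12 x y z :
  associator zorn_mul x y z + associator zorn_mul y x z = 0.
Proof.
case: (zornP x) => *; case: (zornP y) => *; case: (zornP z) => *.
by rewrite /associator !zornE; congr Zorn; ring.
Qed.

Lemma zorn_associatorC23 x y z :
  associator zorn_mul x y z + associator zorn_mul x z y = 0.
Proof.
case: (zornP x) => *; case: (zornP y) => *; case: (zornP z) => *.
by rewrite /associator !zornE; congr Zorn; ring.
Qed.

(** The diagonals enter only through a - b and a' - b', and the value has trace 0. *)
Lemma zorn_commutatorE a u1 u2 u3 v1 v2 v3 b a' u1' u2' u3' v1' v2' v3' b' :
  commutator zorn_mul
    (Zorn a u1 u2 u3 v1 v2 v3 b) (Zorn a' u1' u2' u3' v1' v2' v3' b') =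
  Zorn
   (u1 * v1' + u2 * v2' + u3 * v3' - (v1 * u1' + v2 * u2' + v3 * u3'))
   ((a - b) * u1' - (a' - b') * u1 - (v2 * v3' - v3 * v2') *+ 2)
   ((a - b) * u2' - (a' - b') * u2 - (v3 * v1' - v1 * v3') *+ 2)
   ((a - b) * u3' - (a' - b') * u3 - (v1 * v2' - v2 * v1') *+ 2)
   ((a' - b') * v1 - (a - b) * v1' + (u2 * u3' - u3 * u2') *+ 2)
   ((a' - b') * v2 - (a - b) * v2' + (u3 * u1' - u1 * u3') *+ 2)
   ((a' - b') * v3 - (a - b) * v3' + (u1 * u2' - u2 * u1') *+ 2)
   (v1 * u1' + v2 * u2' + v3 * u3' - (u1 * v1' + u2 * v2' + u3 * v3')).
Proof. by rewrite /commutator !zornE; congr Zorn; ring. Qed.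

Local Notation "[~ x , y ]" := (commutator zorn_mul x y).

(** For an anticommutative product this is Sagle's form of the Malcev identity, which commutators in
    an alternative algebra satisfy; here it is checked in coordinates. *)
Lemma zorn_Malcev x y z t :
  [~ [~ [~ x, y], z], t] - [~ [~ [~ x, t], y], z] - [~ [~ x, [~ z, t]], y]
  - [~ [~ x, z], [~ y, t]] - [~ x, [~ [~ y, z], t]] = 0.
Proof.
case: (zornP x) => *; case: (zornP y) => *; case: (zornP z) => *.
case: (zornP t) => *.
by rewrite !zorn_commutatorE !zornE; congr Zorn; ring.
Qed.

Definition zorn_coord k x : R :=
  let: (a, u1, u2, u3, v1, v2, v3, b) := x in
  nth 0 [:: a : R; u1 : R; u2 : R; u3 : R; v1 : R; v2 : R; v3 : R; b : R] k.

Lemma zorn_coordP k c x y :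
  zorn_coord k (c *: x + y) = c * zorn_coord k x + zorn_coord k y.
Proof.
case: x => [[[[[[[? ?] ?] ?] ?] ?] ?] ?].
case: y => [[[[[[[? ?] ?] ?] ?] ?] ?] ?].
by move: k; do 8 case=> //; move=> k; rewrite /= !nth_nil mulr0 addr0.
Qed.

Lemma zorn_coord0 k : zorn_coord k 0 = 0.
Proof. by move: k; do 8 case=> //; move=> k; exact: nth_nil. Qed.

Lemma zorn_coord_sum (I : Type) (r : seq I) (c : I -> R) (x : I -> zorn) k :
  zorn_coord k (\sum_(i <- r) c i *: x i) =
  \sum_(i <- r) c i * zorn_coord k (x i).
Proof.
elim: r => [|i r IH]; first by rewrite !big_nil zorn_coord0.
by rewrite !big_cons zorn_coordP IH.
Qed.
End Zorn.

(** * Base change of split octonions *)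

Section Map.
Variables (R S : comNzRingType) (f : {rmorphism R -> S}).

Definition zorn_map (x : zorn R) : zorn S :=
  let: (a, u1, u2, u3, v1, v2, v3, b) := x in
  (f a : S, f u1 : S, f u2 : S, f u3 : S,
   f v1 : S, f v2 : S, f v3 : S, f b : S).

Lemma zorn_mapE a u1 u2 u3 v1 v2 v3 b :
  zorn_map (Zorn a u1 u2 u3 v1 v2 v3 b) =
  Zorn (f a) (f u1) (f u2) (f u3) (f v1) (f v2) (f v3) (f b).
Proof. by rewrite !Zorn.unlock. Qed.

(** The structure constants are integers, so evaluations at basis elements can be computed over
    [int] and then carried to [F]. *)
Lemma zorn_map_commutator x y :
  zorn_map (commutator (@zorn_mul R) x y) =
  commutator (@zorn_mul S) (zorn_map x) (zorn_map y).
Proof.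
case: (zornP x) => *; case: (zornP y) => *.
rewrite !(zorn_commutatorE, zorn_mapE).
by congr Zorn; rewrite !(rmorphD, rmorphN, rmorphM, rmorphMn) /=; ring.
Qed.

Lemma zorn_coord_map k x : zorn_coord k (zorn_map x) = f (zorn_coord k x).
Proof.
case: x => [[[[[[[? ?] ?] ?] ?] ?] ?] ?].
by move: k; do 8 case=> //; move=> k; rewrite /= !nth_nil rmorph0.
Qed.
End Map.

(** * Independence of the normal forms *)

(** The operation is arbitrary so that one list serves for monomials, for the free algebra and for
    octonion commutators. The left-normed products are in lexicographic order, the order of the
    cases of [S3_ind]. *)
Definition normal_products (T : Type) (m : T -> T -> T) (a b c d : T) : seq T :=
  [:: m (m (m a b) c) d; m (m (m a b) d) c; m (m (m a c) b) d;
      m (m (m a c) d) b; m (m (m a d) b) c; m (m (m a d) c) b;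
      m (m a b) (m c d); m (m a c) (m b d); m (m a d) (m b c);
      m (m a (m b c)) d].

Lemma map_normal_products (T U : Type) (m : T -> T -> T) (n : U -> U -> U)
    (f : T -> U) a b c d :
  (forall x y, f (m x y) = n (f x) (f y)) ->
  map f (normal_products m a b c d) =
  normal_products n (f a) (f b) (f c) (f d).
Proof. by move=> fM; rewrite /= !fM. Qed.

Section Independence.
Variable F : fieldType.
Hypotheses (char_neq2 : 2%N \notin [pchar F])
  (char_neq3 : 3%N \notin [pchar F]).

Lemma normal_products_independent (c : nat -> F) :
  (forall x y z t : zorn F, \sum_(j < 10)
     c j *: nth 0 (normal_products (commutator (@zorn_mul F)) x y z t) j = 0) ->
  forall j, (j < 10)%N -> c j = 0.
Proof.
move=> rel.
(* Coordinate [k] of the relation at an integral point is a linear equation in the [c j]; its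
   integer coefficients [s] are found by computation. *)
have rel_at (x y z t : zorn int) k (s : seq int) :
    map (zorn_coord k)
      (normal_products (commutator (@zorn_mul int)) x y z t) = s ->
    \sum_(j < 10) c j * (s`_j)%:~R = 0.
  move<-.
  pose phi := @zorn_map int F intr.
  rewrite -[RHS](zorn_coord0 F k) -(rel (phi x) (phi y) (phi z) (phi t)).
  rewrite zorn_coord_sum; apply: eq_bigr => j _; congr (_ * _).
  rewrite -(map_normal_products x y z t (@zorn_map_commutator int F intr)).
  by rewrite !(nth_map 0) ?size_map //= zorn_coord_map.
(* A diagonal idempotent, followed by off-diagonal basis elements. *)
pose e : zorn int := (1, 0, 0, 0, 0, 0, 0, 0).
pose u1 : zorn int := (0, 1, 0, 0, 0, 0, 0, 0).
pose v1 : zorn int := (0, 0, 0, 0, 1, 0, 0, 0).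
pose v2 : zorn int := (0, 0, 0, 0, 0, 1, 0, 0).
pose v3 : zorn int := (0, 0, 0, 0, 0, 0, 1, 0).
(* The evaluations are chosen so that the inverse of the resulting 10 x 10
   matrix has denominators dividing 12. *)
pose r0 := c 4 + c 5.
have r0E : r0 = 0.
  rewrite -[RHS](rel_at e e e u1 1
    [:: 0; 0; 0; 0; 1; 1; 0; 0; 0; 0] erefl).
  by rewrite /r0 !big_ord_recl big_ord0 /=; ring.
pose r1 := 4 * c 4 - 4 * c 5 - 4 * c 8.
have r1E : r1 = 0.
  rewrite -[RHS](rel_at u1 v2 v3 v1 1
    [:: 0; 0; 0; 0; 4; -4; 0; 0; -4; 0] erefl).
  by rewrite /r1 !big_ord_recl big_ord0 /=; ring.
pose r2 := c 2 + c 3 - c 9.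
have r2E : r2 = 0.
  rewrite -[RHS](rel_at e e u1 e 1
    [:: 0; 0; 1; 1; 0; 0; 0; 0; 0; -1] erefl).
  by rewrite /r2 !big_ord_recl big_ord0 /=; ring.
pose r3 := - 2 * c 1 - 2 * c 5 + 2 * c 6 + 2 * c 8.
have r3E : r3 = 0.
  rewrite -[RHS](rel_at u1 e u1 v1 1
    [:: 0; -2; 0; 0; 0; -2; 2; 0; 2; 0] erefl).
  by rewrite /r3 !big_ord_recl big_ord0 /=; ring.
pose r4 := - 2 * c 3 - 2 * c 4 + 2 * c 7 - 2 * c 8.
have r4E : r4 = 0.
  rewrite -[RHS](rel_at u1 u1 e v1 1
    [:: 0; 0; 0; -2; -2; 0; 0; 2; -2; 0] erefl).
  by rewrite /r4 !big_ord_recl big_ord0 /=; ring.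
pose r5 := 4 * c 0 - 4 * c 1 - 4 * c 6 - 8 * c 9.
have r5E : r5 = 0.
  rewrite -[RHS](rel_at u1 v1 v2 v3 1
    [:: 4; -4; 0; 0; 0; 0; -4; 0; 0; -8] erefl).
  by rewrite /r5 !big_ord_recl big_ord0 /=; ring.
pose r6 := c 0 + c 1 + c 9.
have r6E : r6 = 0.
  rewrite -[RHS](rel_at e u1 e e 1
    [:: 1; 1; 0; 0; 0; 0; 0; 0; 0; 1] erefl).
  by rewrite /r6 !big_ord_recl big_ord0 /=; ring.
pose r7 := 2 * c 3 - 2 * c 4 + 4 * c 7 - 2 * c 8.
have r7E : r7 = 0.
  rewrite -[RHS](rel_at u1 v2 e v1 5
    [:: 0; 0; 0; 2; -2; 0; 0; 4; -2; 0] erefl).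
  by rewrite /r7 !big_ord_recl big_ord0 /=; ring.
pose r8 := c 3 + c 5 - c 7 - c 8.
have r8E : r8 = 0.
  rewrite -[RHS](rel_at u1 v1 e e 0
    [:: 0; 0; 0; 1; 0; 1; 0; -1; -1; 0] erefl).
  by rewrite /r8 !big_ord_recl big_ord0 /=; ring.
pose r9 := 2 * c 1 - 2 * c 5 + 4 * c 6 + 2 * c 8.
have r9E : r9 = 0.
  rewrite -[RHS](rel_at u1 e v2 v1 5
    [:: 0; 2; 0; 0; 0; -2; 4; 0; 2; 0] erefl).
  by rewrite /r9 !big_ord_recl big_ord0 /=; ring.
pose rE := (r0E, r1E, r2E, r3E, r4E, r5E, r6E, r7E, r8E, r9E).
have nz12 : 12%:R != 0 :> F.
  rewrite (natrM _ 4 3) (natrM _ 2 2) !mulf_eq0 !negb_or.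
  by move: char_neq2 char_neq3; rewrite !inE /= => -> ->.
have solve (y x : F) : 12%:R * x = y -> y = 0 -> x = 0.
  by move=> <- /eqP; rewrite mulf_eq0 (negPf nz12) => /eqP.
(* The combinations of [r0] to [r9] below are the rows of 12 times the inverse matrix. *)
case=> [|[|[|[|[|[|[|[|[|[|//]]]]]]]]]] _.
- apply: (solve (2 * r0 + 2 * r3 + r4 + r5 + 8 * r6 + 2 * r8));
    last by rewrite !rE; ring.
  by rewrite /r0 /r1 /r2 /r3 /r4 /r5 /r6 /r7 /r8 /r9; ring.
- apply: (solve (- 2 * r0 - 4 * r3 - r4 - 2 * r8 + 2 * r9));
    last by rewrite !rE; ring.
  by rewrite /r0 /r1 /r2 /r3 /r4 /r5 /r6 /r7 /r8 /r9; ring.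
- apply: (solve (2 * r0 + 12 * r2 + 2 * r3 + 3 * r4 - r5 + 4 * r6 - 2 * r7
    - 2 * r8 - 2 * r9));
    last by rewrite !rE; ring.
  by rewrite /r0 /r1 /r2 /r3 /r4 /r5 /r6 /r7 /r8 /r9; ring.
- apply: (solve (- 2 * r0 - 3 * r4 + 2 * r7 + 2 * r8));
    last by rewrite !rE; ring.
  by rewrite /r0 /r1 /r2 /r3 /r4 /r5 /r6 /r7 /r8 /r9; ring.
- apply: (solve (6 * r0 + r1 - r4 - 2 * r8));
    last by rewrite !rE; ring.
  by rewrite /r0 /r1 /r2 /r3 /r4 /r5 /r6 /r7 /r8 /r9; ring.
- apply: (solve (6 * r0 - r1 + r4 + 2 * r8));
    last by rewrite !rE; ring.
  by rewrite /r0 /r1 /r2 /r3 /r4 /r5 /r6 /r7 /r8 /r9; ring.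
- apply: (solve (4 * r0 + 2 * r3 + 2 * r4 + 4 * r8 + 2 * r9));
    last by rewrite !rE; ring.
  by rewrite /r0 /r1 /r2 /r3 /r4 /r5 /r6 /r7 /r8 /r9; ring.
- apply: (solve (4 * r0 + 2 * r7 - 4 * r8));
    last by rewrite !rE; ring.
  by rewrite /r0 /r1 /r2 /r3 /r4 /r5 /r6 /r7 /r8 /r9; ring.
- apply: (solve (- r1 - 2 * r4 - 4 * r8));
    last by rewrite !rE; ring.
  by rewrite /r0 /r1 /r2 /r3 /r4 /r5 /r6 /r7 /r8 /r9; ring.
- apply: (solve (2 * r3 - r5 + 4 * r6 - 2 * r9));
    last by rewrite !rE; ring.
  by rewrite /r0 /r1 /r2 /r3 /r4 /r5 /r6 /r7 /r8 /r9; ring.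
Qed.
End Independence.

(** * Normal forms of multilinear monomials *)

Section SpanModulo.
Variables (F : fieldType) (V : lmodType F) (J : V -> Prop).
Hypotheses (J0 : J 0) (JD : forall f g, J f -> J g -> J (f + g))
  (JZ : forall (k : F) f, J f -> J (k *: f)).
Variables (I : finType) (e : I -> V).

Definition span_modulo (f : V) : Prop :=
  exists c : I -> F, J (f - \sum_i c i *: e i).

Lemma span_moduloP k f g :
  span_modulo f -> span_modulo g -> span_modulo (k *: f + g).
Proof.
case=> c Jf [d Jg]; exists (fun i => k * c i + d i).
rewrite (eq_bigr (fun i => k *: (c i *: e i) + d i *: e i)); last first.
  by move=> i _; rewrite scalerDl scalerA.
by rewrite big_split /= -scaler_sumr opprD addrACA -scalerBr; apply/JD/Jg/JZ.
Qed.

Lemma span_modulo_sub f : J f -> span_modulo f.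
Proof.
by move=> Jf; exists (fun=> 0); rewrite big1 ?subr0 // => i _; rewrite scale0r.
Qed.

Lemma span_modulo_mem i : span_modulo (e i).
Proof.
exists (fun j => (j == i)%:R); rewrite (bigD1 i) //= eqxx scale1r.
rewrite big1 ?addr0 ?subrr // => j /negPf ->; exact: scale0r.
Qed.

Lemma span_moduloD f g : span_modulo f -> span_modulo g -> span_modulo (f + g).
Proof. by move=> Sf Sg; rewrite -[f]scale1r; exact: span_moduloP. Qed.

Lemma span_moduloN f : span_modulo f -> span_modulo (- f).
Proof.
move=> Sf; rewrite -[- f]addr0 -scaleN1r; apply: span_moduloP => //.
exact: span_modulo_sub.
Qed.

Lemma span_modulo_sum (K : eqType) (r : seq K) (c : K -> F) (x : K -> V) :
  (forall k, k \in r -> span_modulo (x k)) ->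
  span_modulo (\sum_(k <- r) c k *: x k).
Proof.
elim: r => [|k r IH] Sx; first by rewrite big_nil; exact: span_modulo_sub.
rewrite big_cons; apply: span_moduloP; first by apply: Sx; rewrite inE eqxx.
by apply: IH => l lr; apply: Sx; rewrite inE lr orbT.
Qed.
End SpanModulo.

(** * Bracketings of degree four *)

Section Shapes.
Variable X : Type.
Implicit Types s t : magma X.

Lemma magma_leaves_gt0 t : (0 < size (magma_leaves t))%N.
Proof. by elim: t => //= s IHs t _; rewrite size_cat addn_gt0 IHs. Qed.

Lemma magma_leaves_size1 t : size (magma_leaves t) = 1%N ->
  exists x, t = MVar x.
Proof.
case: t => [x _|s t] /=; first by exists x.
by rewrite size_cat; move: (magma_leaves_gt0 s) (magma_leaves_gt0 t); lia.
Qed.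

Lemma magma_leaves_size2 t : size (magma_leaves t) = 2%N ->
  exists x y, t = MMul (MVar x) (MVar y).
Proof.
case: t => [//|s t] /=; rewrite size_cat => st.
have := magma_leaves_gt0 s; have := magma_leaves_gt0 t => t0 s0.
have [[x ->] [y ->]] : (exists x, s = MVar x) /\ (exists y, t = MVar y).
  by split; apply: magma_leaves_size1; lia.
by exists x, y.
Qed.

Lemma magma_leaves_size3 t : size (magma_leaves t) = 3%N ->
  exists x y z, t = MMul (MMul (MVar x) (MVar y)) (MVar z) \/
    t = MMul (MVar x) (MMul (MVar y) (MVar z)).
Proof.
case: t => [//|s t] /=; rewrite size_cat => st.
have := magma_leaves_gt0 s; have := magma_leaves_gt0 t => t0 s0.
have [s1|s2] : size (magma_leaves s) = 1%N \/ size (magma_leaves s) = 2%N.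
    by lia.
  have [x ->] := magma_leaves_size1 s1.
  have [|y [z ->]] := @magma_leaves_size2 t; first lia.
  by exists x, y, z; right.
have [x [y ->]] := magma_leaves_size2 s2.
have [|z ->] := @magma_leaves_size1 t; first lia.
by exists x, y, z; left.
Qed.

Lemma magma_ind4 (P : magma X -> Prop) :
  (forall x y z w : X, let m := @MMul X in let v := @MVar X in
    [/\ P (m (m (m (v x) (v y)) (v z)) (v w)),
        P (m (m (v x) (m (v y) (v z))) (v w)),
        P (m (m (v x) (v y)) (m (v z) (v w))),
        P (m (v x) (m (m (v y) (v z)) (v w))) &
        P (m (v x) (m (v y) (m (v z) (v w))))]) ->
  forall t, size (magma_leaves t) = 4%N -> P t.
Proof.
move=> Pm [//|s t] /=; rewrite size_cat => st.
have := magma_leaves_gt0 s; have := magma_leaves_gt0 t => t0 s0.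
have [s1|[s2|s3]] : size (magma_leaves s) = 1%N \/ size (magma_leaves s) = 2%N
  \/ size (magma_leaves s) = 3%N by lia.
- have [x ->] := magma_leaves_size1 s1.
  have [|y [z [w [|] ->]]] := @magma_leaves_size3 t; first lia;
    by case: (Pm x y z w).
- have [x [y ->]] := magma_leaves_size2 s2.
  have [|z [w ->]] := @magma_leaves_size2 t; first lia.
  by case: (Pm x y z w).
have [x [y [z xyz]]] := magma_leaves_size3 s3.
have [|w ->] := @magma_leaves_size1 t; first lia.
by case: xyz => ->; case: (Pm x y z w).
Qed.
End Shapes.

(** [lift x] lists the three letters different from [x] in increasing order; natural indices fit the
    family [x] of [di_Malcev_span]. *)
Definition other (x : 'I_4) (n : nat) : 'I_4 := lift x (inord n : 'I_3).

(** Letters different from [x] lie in the image of [lift x]. Their preimages are three distinct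
    elements of a set of three, hence a permutation of it. *)
Lemma perm_eq_others (x y z w : 'I_4) :
  perm_eq [:: x; y; z; w] (enum 'I_4) -> exists i j k,
    perm_eq [:: i; j; k] (iota 0 3) /\
    [:: y; z; w] = [:: other x i; other x j; other x k].
Proof.
move=> /perm_uniq; rewrite enum_uniq /= !inE !negb_or.
case/and3P=> /and3P[xy xz xw] /andP[yz yw] /andP[zw _].
have [i yi _] := unlift_some xy; have [j zj _] := unlift_some xz.
have [k wk _] := unlift_some xw.
exists i, j, k; split; last by rewrite /other !inord_val -yi -zj -wk.
rewrite -[X in perm_eq _ X](val_enum_ord 3).
apply: (perm_map val (s := [:: i; j; k])).
have ijk : uniq [:: i; j; k].
  rewrite -(map_inj_uniq (@lift_inj _ x)) /= -yi -zj -wk /= !inE negb_or.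
  by rewrite yz yw zw.
apply: uniq_perm; rewrite ?enum_uniq //.
apply: (uniq_min_size ijk _ _).2 => [l|]; first by rewrite mem_enum.
by rewrite size_enum_ord.
Qed.

Section Normal.
Variable F : fieldType.
Local Notation A := (free_na F 'I_4).
Local Notation J := (consequence (@Malcev_dialgebra_identities F)).

(** The pair gives the leftmost letter and the position among its ten normal products; the default
    of [nth] is never reached. *)
Definition normal_monomial (p : 'I_4 * 'I_10) : magma 'I_4 :=
  nth (MVar p.1) (normal_products (@MMul 'I_4) (MVar p.1)
    (MVar (other p.1 0)) (MVar (other p.1 1)) (MVar (other p.1 2))) p.2.

Local Notation normal p := (<< normal_monomial p >> : A).
Local Notation W := (span_modulo J (fun p => normal p)).

Let TJ := consequence_T_ideal (@Malcev_dialgebra_identities F).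

Lemma normal_products_span x j : (j < 10)%N ->
  W (nth 0 (normal_products (@na_mul F 'I_4) (na_var F x)
    (na_var F (other x 0)) (na_var F (other x 1)) (na_var F (other x 2))) j).
Proof.
move=> j10.
pose ev t := magma_eval (@na_mul F 'I_4) (@na_var F 'I_4) t.
have := span_modulo_mem (T_ideal0 TJ) (fun p => normal p) (x, Ordinal j10).
congr W; rewrite -magma_eval_na_var.
pose ts := normal_products (@MMul 'I_4) (MVar x)
  (MVar (other x 0)) (MVar (other x 1)) (MVar (other x 2)).
transitivity (nth 0 (map ev ts) j); first by rewrite (nth_map (MVar x)).
by congr (nth 0 _ j); exact: map_normal_products.
Qed.

Lemma span_multilinear_monomial (t : magma 'I_4) :
  perm_eq (magma_leaves t) (enum 'I_4) -> W << t >>.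
Proof.
move=> t_perm; rewrite -magma_eval_na_var.
have t4 : size (magma_leaves t) = 4%N.
  by rewrite (perm_size t_perm) size_enum_ord.
move: t t4 t_perm; apply: magma_ind4 => x y z w.
have WD := span_moduloD (T_idealD TJ) (T_idealZ TJ).
have WN := span_moduloN (T_ideal0 TJ) (T_idealD TJ) (T_idealZ TJ).
have WJ := @span_modulo_sub F A J _ (fun p => normal p).
have W_span := @di_Malcev_span A (@na_mul F 'I_4) W (WD _ _) (WN _ _)
  (fun a b c => WJ _ (consequence_right_anticommutativity a b c))
  (fun a b c d => WJ _ (consequence_anticomml a b c d))
  (fun a b c d => WJ _ (consequence_nested_anticomm a b c d))
  (fun a b c d => WJ _ (consequence_di_Malcev a b c d)) (na_var F x)
  (fun n => na_var F (other x n)).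
have W_nf j (j10 : (j < 10)%N) := normal_products_span x j10.
(* The ten normal products discharge the ten hypotheses of the reduction. *)
have {}W_span : forall i j k, perm_eq [:: i; j; k] (iota 0 3) -> _ :=
  W_span (S3_ind (W_nf 0 isT) (W_nf 1 isT) (W_nf 2 isT) (W_nf 3 isT)
   (W_nf 4 isT) (W_nf 5 isT)) (W_nf 6 isT) (W_nf 7 isT)
   (W_nf 8 isT) (W_nf 9 isT).
split=> /perm_eq_others[i [j [k [/W_span[W1 W2 W3 W4 W5] [-> -> ->]]]]].
- exact: W1.
- exact: W2.
- exact: W3.
- exact: W4.
- exact: W5.
Qed.

Lemma span_multilinear (f : A) : multilinear f -> W f.
Proof.
move=> f_multi; rewrite (free_naE f).
apply: (span_modulo_sum (T_ideal0 TJ) (T_idealD TJ) (T_idealZ TJ)) => t tf.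
exact/span_multilinear_monomial/f_multi.
Qed.
End Normal.

(** * Independence of the forty normal monomials, and the theorem *)

Section ZornIndependence.
Variable F : fieldType.
Hypotheses (char_neq2 : 2%N \notin [pchar F])
  (char_neq3 : 3%N \notin [pchar F]).
Local Notation dl := (null_left (@zorn_mul F)).
Local Notation dr := (null_right (@zorn_mul F)).

Lemma zorn_null_alternative : alternative_dialgebra dl dr.
Proof.
exact: null_alternative (@zorn_associatorC12 F) (@zorn_associatorC23 F).
Qed.

Lemma zorn_null_consequence f :
  consequence (@Malcev_dialgebra_identities F) f ->
  satisfies (dicommutator dl dr) f.
Proof. exact/null_consequence/zorn_Malcev. Qed.

Lemma magma_head_normal p : magma_head (normal_monomial p) = p.1.
Proof. by case: p => x [j j10]; do 10?[case: j j10 => [//|j] j10]. Qed.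

Lemma snd_sum (V : lmodType F) (I : finType) (c : I -> F) (x : I -> V * V) :
  (\sum_i c i *: x i).2 = \sum_i c i *: (x i).2.
Proof. by elim/big_rec2: _ => // i _ y _ <-. Qed.

Lemma normal_independent (c : 'I_4 * 'I_10 -> F) :
  satisfies (dicommutator dl dr)
    (\sum_p c p *: (<< normal_monomial p >> : free_na F 'I_4)) ->
  forall p, c p = 0.
Proof.
move=> sat [a j]; rewrite -[j]inord_val.
apply: (@normal_products_independent F char_neq2 char_neq3
  (fun n => c (a, inord n))) => // x y z t.
pose u b : zorn F := oapp (fun m : 'I_3 => [:: y; z; t]`_m) x (unlift a b).
(* Only the letter [a] has a module part, so monomials with another leftmost letter vanish in the
   second component, and the rest become commutators evaluated at [u]. *)
pose v b : zorn F * zorn F := (u b, if b == a then u b else 0).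
have := congr1 snd (sat v); rewrite na_eval_sum snd_sum.
have pairE (G : 'I_4 * 'I_10 -> zorn F) :
    \sum_p G p = \sum_i \sum_j G (i, j).
  by rewrite pair_bigA; apply: eq_bigr => -[].
rewrite pairE.
rewrite (bigD1 a) //= [X in _ + X]big1 ?addr0; last first.
  move=> i ia; rewrite big1 // => k _; rewrite na_evalU.
  rewrite null_eval2_0 ?scaler0 //.
  by rewrite magma_head_normal /= (negPf ia).
move=> sum0; rewrite -[RHS]sum0; apply: eq_bigr => k _.
rewrite inord_val; congr (_ *: _).
rewrite na_evalU null_eval2 ?magma_head_normal /= ?eqxx //.
pose ev := magma_eval (commutator (@zorn_mul F)) u.
have ua : u a = x by rewrite /u unlift_none.
have uo n : (n < 3)%N -> u (other a n) = [:: y; z; t]`_n.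
  by move=> n3; rewrite /u /other liftK /= inordK.
have -> : normal_products (commutator (@zorn_mul F)) x y z t =
    map ev (normal_products (@MMul 'I_4) (MVar a) (MVar (other a 0))
      (MVar (other a 1)) (MVar (other a 2))).
  rewrite -ua -[y](uo 0%N isT) -[z](uo 1%N isT) -[t](uo 2%N isT).
  exact/esym/map_normal_products.
by rewrite (nth_map (MVar a)).
Qed.
End ZornIndependence.

Theorem theorem17 (F : fieldType)
  (char_neq2 : 2%N \notin [pchar F]) (char_neq3 : 3%N \notin [pchar F])
  (f : free_na F 'I_4) (f_multilinear : multilinear f)
  (f_dicommutator : forall (D : lmodType F) (dl dr : {bilinear D -> D -> D}),
    alternative_dialgebra dl dr -> satisfies (dicommutator dl dr) f) :
  consequence (@Malcev_dialgebra_identities F) f.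
Proof.
have [c Jfc] := span_multilinear f_multilinear.
have c0 p : c p = 0.
  apply: normal_independent p => // v.
  (* Both [f] and its difference from the normal form vanish in the octonion dialgebra, hence so
     does the normal form. *)
  have := zorn_null_consequence Jfc v; rewrite na_evalB.
  have -> := f_dicommutator _ _ _ (zorn_null_alternative F) v.
  by rewrite sub0r => /eqP; rewrite oppr_eq0 => /eqP.
by move: Jfc; rewrite big1 ?subr0 // => p _; rewrite c0 scale0r.
Qed.
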